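(* Let $\rho>0$ and let $K$ be a nonnegative integer. The total number of customers $N_K$ at steady state in the symmetric join-the-shortest-queue model with two queues of capacity $K$ is such that $$\mathbb P(N_K=n)\le\frac{\pi_K(K,K)}{\rho^{2K}}\,\rho^n,\qquad 0\le n<K,$$ $$\mathbb P(N_K=n)=\frac{\pi_K(K,K)}{\rho^{2K}}\,\rho^n,\qquad K\le n\le 2K,$$ where $$\pi_K(K,K)=\frac{2\rho^{2K}}{2\sum_{k=0}^{2K}\rho^k-\sum_{k=0}^{K-1}(\rho/2)^k}.$$
   Context: Symmetric finite-capacity JSQ model: two one-server queues, each of capacity $K$; service times are exponential with parameter $1$ at both queues; customers arrive according to a Poisson process with parameter $2\rho$ and join the shortest queue, or either queue with probability $1/2$ if both lengths are equal; when both queues have length $K$ arriving customers are lost. The queue-length process $(L_1(t),L_2(t))_{t\ge0}$ is the continuous-time Markov chain on $\{0,\dots,K\}^2$ with the following transition rates ($e_1,e_2$ the unit vectors). From $(k,k)$: to $(k,k)+e_1$ and to $(k,k)+e_2$ at rate $\rho$ each if $k<K$; to $(k,k)-e_1$ and to $(k,k)-e_2$ at rate $1$ each if $k>0$. From $(j,k)$ with $j<k$: to $(j+1,k)$ at rate $2\rho$, to $(j-1,k)$ at rate $1$ if $j>0$, to $(j,k-1)$ at rate $1$. From $(k,j)$ with $j<k$: to $(k,j+1)$ at rate $2\rho$, to $(k,j-1)$ at rate $1$ if $j>0$, to $(k-1,j)$ at rate $1$. The chain is irreducible, and $\pi_K$ denotes its unique invariant probability distribution. $N_K=L_1+L_2$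 where $(L_1,L_2)$ has distribution $\pi_K$. An empty sum is $0$. *)

(* Defs.v *)
From HB Require Import structures.
From mathcomp Require Import all_boot all_order all_algebra.
Set Implicit Arguments.
Unset Strict Implicit.
Unset Printing Implicit Defensive.
Import Order.TTheory GRing.Theory Num.Theory.
Local Open Scope ring_scope.

(* The symmetric join-the-shortest-queue model: two one-server queues of
   capacity K, unit service rates, total arrival rate 2 * rho.
   A state is the pair of queue lengths, an element of {0, ..., K}^2. *)
Definition jsq_state (K : nat) : finType := ('I_K.+1 * 'I_K.+1)%type.

(* Rate at which customers are sent to a queue of length a while the other
   queue has length b. *)
Definition jsq_arrival (R : realFieldType) (rho : R) (a b : nat) : R :=
  if (a < b)%N then 2 * rho else if a == b then rho else 0.

(* Rate of the jump s -> t for s <> t (the value is 0 when s = t).  Since t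
   ranges over {0, ..., K}^2, an arrival needs a non-full queue (so arrivals
   at (K, K) are lost), and since c.+1 > 0 a service needs a nonempty one. *)
Definition jsq_rate (R : realFieldType) (K : nat) (rho : R)
    (s t : jsq_state K) : R :=
  let a := s.1 : nat in let b := s.2 : nat in
  let c := t.1 : nat in let d := t.2 : nat in
  if (c == a.+1) && (d == b) then jsq_arrival rho a b
  else if (c == a) && (d == b.+1) then jsq_arrival rho b a
  else if (a == c.+1) && (b == d) then 1
  else if (a == c) && (b == d.+1) then 1
  else 0.

Definition jsq_generator (R : realFieldType) (K : nat) (rho : R)
    (s t : jsq_state K) : R :=
  if s == t then - \sum_(u : jsq_state K | u != s) jsq_rate rho s u
  else jsq_rate rho s t.

Definition is_distribution (R : realFieldType) (T : finType) (p : T -> R) :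
    Prop :=
  (forall s, 0 <= p s) /\ \sum_(s : T) p s = 1.

(* p Q = 0, for Q the generator of a Markov chain on T. *)
Definition invariant_measure (R : realFieldType) (T : finType)
    (Q : T -> T -> R) (p : T -> R) : Prop :=
  forall t, \sum_(s : T) p s * Q s t = 0.

Definition jsq_invariant_distribution (R : realFieldType) (K : nat) (rho : R)
    (p : jsq_state K -> R) : Prop :=
  is_distribution p /\ invariant_measure (jsq_generator (K := K) rho) p.

Definition prob (R : realFieldType) (T : finType) (p : T -> R) (A : pred T) :
    R :=
  \sum_(s : T | A s) p s.

Definition jsq_total (K : nat) (s : jsq_state K) : nat := (s.1 + s.2)%N.

(* Main.v *)
(** For every function F on the states, the mean under an invariant
    distribution of the drift Q F is zero.  Taking for F the indicator of
    [n < N] balances the flow across level n: [2 rho P(N = n)] is the mean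
    number of busy servers on [N = n + 1], which is at most
    [2 P(N = n + 1)], with equality when n >= K because then no server is idle.
    The normalization comes from an explicit solution g of the Poisson equation
    [Q g = 1 - c 1_{(K, K)}], that is, up to sign and an additive constant, the
    mean hitting time of (K, K); it gives [c pi(K, K) = 1]. *)
Require Import Defs.
From mathcomp Require Import all_boot all_order all_algebra.
From mathcomp Require Import ring zify.
Import Order.TTheory GRing.Theory Num.Theory.
Local Open Scope ring_scope.

(** * The generator acting on functions of the two queue lengths *)

Definition jsq_drift (R : realFieldType) (K : nat) (rho : R)
    (F : nat -> nat -> R) (a b : nat) : R :=
  (if (a < K)%N then jsq_arrival rho a b * (F a.+1 b - F a b) else 0)
  + (if (b < K)%N then jsq_arrival rho b a * (F a b.+1 - F a b) else 0)
  + (if (0 < a)%N then F a.-1 b - F a b else 0)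
  + (if (0 < b)%N then F a b.-1 - F a b else 0).

Arguments jsq_drift {R} K rho F a b.

Lemma sum_pair_pred1 (R : realFieldType) (K : nat) (c d : nat)
    (H : nat -> nat -> R) :
  \sum_(t : jsq_state K) (if (t.1 == c :> nat) && (t.2 == d :> nat)
                          then H t.1 t.2 else 0)
  = if (c <= K)%N && (d <= K)%N then H c d else 0.
Proof.
rewrite -big_mkcond /=; case: ifP => [/andP[hc hd]|hcd].
  rewrite (big_pred1 ((inord c, inord d) : jsq_state K)) /= ?inordK //.
  by case=> i j; rewrite /= xpair_eqE -!val_eqE /= !inordK.
rewrite big_pred0 //= => -[i j] /=; apply/negP => /andP[/eqP hi /eqP hj].
by move: hcd; rewrite -hi -hj (leq_ord i) (leq_ord j).
Qed.

Lemma jsq_rate_self (R : realFieldType) (K : nat) (rho : R) (s : jsq_state K) :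
  jsq_rate rho s s = 0.
Proof.
rewrite /jsq_rate; do 4 (case: ifP => [/andP[]|_]; first by lia).
by [].
Qed.

(** The diagonal entry is minus the total exit rate, so it subtracts [F] at [s] with the rate of
    each jump and only increments of [F] remain. *)
Lemma jsq_generator_drift (R : realFieldType) (K : nat) (rho : R)
    (F : nat -> nat -> R) (s : jsq_state K) :
  \sum_(t : jsq_state K) jsq_generator rho s t * F t.1 t.2
  = jsq_drift K rho F s.1 s.2.
Proof.
have -> : \sum_(t : jsq_state K) jsq_generator rho s t * F t.1 t.2
    = \sum_(t : jsq_state K) jsq_rate rho s t * (F t.1 t.2 - F s.1 s.2).
  rewrite (bigD1 s) //= [RHS](bigD1 s) //= subrr mulr0 add0r.
  rewrite {1}/jsq_generator eqxx mulNr mulr_suml -sumrN -big_split /=.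
  apply: eq_bigr => t hts; rewrite /jsq_generator eq_sym (negbTE hts).
  by rewrite mulrBr addrC.
case: s => a b /=.
have hrate (t : jsq_state K) :
    jsq_rate rho ((a, b) : jsq_state K) t * (F t.1 t.2 - F a b)
  = (if (t.1 == a.+1 :> nat) && (t.2 == b :> nat)
     then jsq_arrival rho a b * (F t.1 t.2 - F a b) else 0)
  + (if (t.1 == a :> nat) && (t.2 == b.+1 :> nat)
     then jsq_arrival rho b a * (F t.1 t.2 - F a b) else 0)
  + (if (0 < a)%N then if (t.1 == a.-1 :> nat) && (t.2 == b :> nat)
     then F t.1 t.2 - F a b else 0 else 0)
  + (if (0 < b)%N then if (t.1 == a :> nat) && (t.2 == b.-1 :> nat)
     then F t.1 t.2 - F a b else 0 else 0).
  rewrite /jsq_rate /=.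
  case: t => [[c hc] [d hd]] /=; case: a b => [a ha] [b hb] /=.
  (* The predecessor form expresses the target through the source, as [sum_pair_pred1] needs; the
     guard keeps [0.-1 = 0] from creating a false jump. *)
  have -> : (a == c.+1) && (b == d) = (0 < a)%N && ((c == a.-1) && (d == b)).
    by lia.
  have -> : (a == c) && (b == d.+1) = (0 < b)%N && ((c == a) && (d == b.-1)).
    by lia.
  rewrite -!(if_and (0 < _)%N).
  (* The four jump conditions exclude one another, so the nested conditionals of [jsq_rate] turn
     into a sum. *)
  have : pairwise (fun x y => ~~ (x && y))
    [:: (c == a.+1) && (d == b); (c == a) && (d == b.+1);
        (0 < a)%N && ((c == a.-1) && (d == b));
        (0 < b)%N && ((c == a) && (d == b.-1))].
    by rewrite /= !andbT; lia.
  move: (_ && (d == b)) (_ && (d == b.+1)) ((0 < a)%N && _) ((0 < b)%N && _).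
  by do 4 case=> //=; rewrite ?mul0r ?mul1r ?addr0 ?add0r.
under eq_bigr => t _ do rewrite hrate.
have ha := ltn_ord a; have hb := ltn_ord b.
rewrite !big_split /= /jsq_drift; congr (_ + _ + _ + _).
- by rewrite (sum_pair_pred1 _ _ _ _ (fun c d => jsq_arrival rho a b * (F c d - F a b)))
    -(ltnS b) hb andbT.
- by rewrite (sum_pair_pred1 _ _ _ _ (fun c d => jsq_arrival rho b a * (F c d - F a b)))
    -(ltnS a) ha.
- case: ifP => h; last by rewrite big1.
  rewrite (sum_pair_pred1 _ _ _ _ (fun c d => F c d - F a b)).
  by rewrite ifT //; lia.
- case: ifP => h; last by rewrite big1.
  rewrite (sum_pair_pred1 _ _ _ _ (fun c d => F c d - F a b)).
  by rewrite ifT //; lia.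
Qed.

Lemma invariant_drift (R : realFieldType) (K : nat) (rho : R)
    (p : jsq_state K -> R) (F : nat -> nat -> R) :
  invariant_measure (jsq_generator rho) p ->
  \sum_(s : jsq_state K) p s * jsq_drift K rho F s.1 s.2 = 0.
Proof.
move=> hp; under eq_bigr => s _ do rewrite -jsq_generator_drift mulr_sumr.
rewrite exchange_big /= big1 // => t _.
under eq_bigr => s _ do rewrite mulrA.
by rewrite -mulr_suml hp mul0r.
Qed.

Lemma jsq_drift_sym (R : realFieldType) (K : nat) (rho : R)
    (F : nat -> nat -> R) (a b : nat) :
  (forall c d, F c d = F d c) -> jsq_drift K rho F a b = jsq_drift K rho F b a.
Proof.
move=> hF; rewrite /jsq_drift (hF a b) (hF a.+1) (hF a b.+1) (hF a.-1).
by rewrite (hF a b.-1) [X in X + _ + _]addrC -!addrA; congr (_ + (_ + _)); rewrite addrC.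
Qed.

(** * Explicit solution of the Poisson equation *)

Definition geom_sum (R : realFieldType) (r : R) (n : nat) : R :=
  \sum_(0 <= i < n) r ^+ i.

(** For r other than 1/2 this is (r^n - 2^-n) / (r - 1/2). *)
Definition mixed_sum (R : realFieldType) (r : R) (n : nat) : R :=
  \sum_(0 <= i < n) r ^+ (n - i.+1) * 2^-1 ^+ i.

(* [potential_dr] and [potential_dl] are the increments of the potential at
   (j, k), j <= k, when the longer, resp. shorter, queue grows; the latter is
   meaningful for j < k only.  With r = 1 / rho, the equations of the potential
   are solved by a combination of j + k, (r / 2)^j, r^(j + k) and 2^-j r^k
   with coefficients having poles at rho = 1/2, 1, 2; writing it with geometric
   sums keeps these values of rho from being exceptional. *)
Definition potential_dr (R : realFieldType) (r : R) (j k : nat) : R :=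
  r / 2 * (geom_sum R r (j + k).+1 - r ^+ k.+1 * mixed_sum R r j / 2).

Definition potential_dl (R : realFieldType) (r : R) (j k : nat) : R :=
  r / 2 * (geom_sum R r (j + k).+1 - (r / 2) ^+ j.+1 * geom_sum R r (k - j.+1)
           - r ^+ k * mixed_sum R r j.+1 / 2).

(** The increments are summed along the path (0, 0), (0, k), (j, k), which stays in the region where
    the first coordinate is the shorter queue. *)
Definition potential (R : realFieldType) (r : R) (j k : nat) : R :=
  \sum_(0 <= i < k) potential_dr R r 0 i + \sum_(0 <= i < j) potential_dl R r i k.

Arguments geom_sum {R} r n.
Arguments mixed_sum {R} r n.
Arguments potential_dr {R} r j k.
Arguments potential_dl {R} r j k.
Arguments potential {R} r j k.

Lemma geom_sumSr (R : realFieldType) (r : R) (n : nat) :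
  geom_sum r n.+1 = geom_sum r n + r ^+ n.
Proof. by rewrite /geom_sum big_nat_recr. Qed.

Lemma geom_sumSl (R : realFieldType) (r : R) (n : nat) :
  geom_sum r n.+1 = 1 + r * geom_sum r n.
Proof.
rewrite /geom_sum big_nat_recl //= expr0 mulr_sumr.
by under eq_bigr do rewrite exprS.
Qed.

Lemma mixed_sumS (R : realFieldType) (r : R) (n : nat) :
  mixed_sum r n.+1 = r * mixed_sum r n + 2^-1 ^+ n.
Proof.
rewrite /mixed_sum big_nat_recr //= subnn expr0 mul1r mulr_sumr.
congr (_ + _); apply: eq_big_nat => i /andP[_ hi].
by rewrite mulrA -exprS; congr (_ ^+ _ * _); lia.
Qed.

Lemma potentialSl (R : realFieldType) (r : R) (j k : nat) :
  potential r j.+1 k = potential r j k + potential_dl r j k.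
Proof. by rewrite /potential big_nat_recr //= addrA. Qed.

(** The increments around a unit square cancel; hence the potential does not depend on the path
    chosen to define it, which yields [potentialSr]. *)
Lemma potential_curl (R : realFieldType) (r : R) (j k : nat) : (j < k)%N ->
  potential_dl r j k + potential_dr r j.+1 k
  = potential_dr r j k + potential_dl r j k.+1.
Proof.
move=> /subnKC <-; set e := (k - j.+1)%N.
have -> : (j.+1 + e).+1 = (j.+1 + e.+1)%N by rewrite addnS.
rewrite /potential_dl /potential_dr !addKn (geom_sumSr R r e) !addSn !addnS.
rewrite !mixed_sumS !exprS !exprD !exprMn.
by field.
Qed.

Lemma potentialSr (R : realFieldType) (r : R) (j k : nat) : (j <= k)%N ->
  potential r j k.+1 = potential r j k + potential_dr r j k.
Proof.
elim: j => [|j IH] hjk.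
  by rewrite /potential big_nat_recr //= ![\sum_(0 <= i < 0) _]big_geq // !addr0.
rewrite !potentialSl (IH (ltnW hjk)) -!addrA; congr (_ + _).
by rewrite potential_curl.
Qed.

(** With r = 1 / rho this is [2 * rho * potential_dr r K K], the arrival term that is lost at (K,
    K): the drift there is 1 minus this value. *)
Definition drift_const (R : realFieldType) (r : R) (K : nat) : R :=
  geom_sum r (2 * K).+1 - r ^+ K.+1 * mixed_sum r K / 2.
Arguments drift_const {R} r K.

Lemma drift_potential (R : realFieldType) (rho : R) (K a b : nat) :
  0 < rho -> (a <= K)%N -> (b <= K)%N ->
  jsq_drift K rho (fun a b => potential rho^-1 (minn a b) (maxn a b)) a b
  = 1 - drift_const rho^-1 K * ((a == K) && (b == K))%:R.
Proof.
move=> hrho; have rho0 : rho != 0 by rewrite gt_eqF.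
wlog hab : a b / (a <= b)%N.
  move=> hw ha hb; case: (leqP a b) => [|/ltnW] h; first exact: hw.
  by rewrite jsq_drift_sym ?hw 1?andbC // => c d; rewrite minnC maxnC.
move=> ha hb; rewrite /jsq_drift /jsq_arrival /=.
case: (ltngtP a b) hab => [hab _||<- _] //; last first.
  rewrite {hb}.
  (* A departure on the diagonal shortens what becomes the shorter queue, so the increment is a
     [potential_dl] whose second geometric sum is empty. *)
  have hdown : (0 < a)%N -> potential rho^-1 a.-1 a - potential rho^-1 a a
      = - (rho^-1 / 2 * (geom_sum rho^-1 (a + a)
                       - rho^-1 ^+ a * mixed_sum rho^-1 a / 2)).
    case: a ha => // a _ _; rewrite potentialSl /potential_dl subnn.
    by rewrite [geom_sum _ 0]big_geq // addSn -addnS mulr0 subr0 /=; ring.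
  have hup : potential rho^-1 a a.+1 - potential rho^-1 a a
     = rho^-1 / 2 * (geom_sum rho^-1 (a + a).+1
                     - rho^-1 ^+ a.+1 * mixed_sum rho^-1 a / 2).
    by rewrite potentialSr // addrC addKr.
  rewrite (minn_idPr (leqnSn a)) (maxn_idPl (leqnSn a)).
  rewrite (minn_idPl (leqnSn a)) (maxn_idPr (leqnSn a)).
  rewrite (minn_idPl (leq_pred a)) (maxn_idPr (leq_pred a)).
  rewrite (minn_idPr (leq_pred a)) (maxn_idPl (leq_pred a)).
  rewrite andbb hup.
  case: (ltngtP a K) ha => [haK _||<- _] //.
    rewrite mulr0 subr0; case: (posnP a) => [->|ha].
      by rewrite /geom_sum /mixed_sum [\sum_(0 <= i < 0) _]big_geq // big_nat1 expr0; field.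
    rewrite hdown // geom_sumSl exprS; by field.
  rewrite mulr1 !addr0 /drift_const mul2n -addnn; case: (posnP a) => [->|ha].
    by rewrite /geom_sum /mixed_sum [\sum_(0 <= i < 0) _]big_geq // big_nat1 expr0; field.
  rewrite hdown // geom_sumSl exprS; by field.
(* Off the diagonal the shorter queue has room, so the capacity never matters and arrivals use
   [potential_dl] only. *)
rewrite (leq_trans hab hb) (leq_trans _ hab) //.
rewrite (minn_idPl hab) (maxn_idPr hab).
rewrite (_ : (a == K) = false) /= ?mulr0 ?subr0 ?mul0r ?if_same ?addr0; last by lia.
rewrite (minn_idPl (_ : a <= b.-1)%N) ?(maxn_idPr (_ : a <= b.-1)%N); try lia.
rewrite (minn_idPl (_ : a.-1 <= b)%N) ?(maxn_idPr (_ : a.-1 <= b)%N); try lia.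
case: b hab hb => // b; rewrite ltnS => hab hb /=.
rewrite potentialSl [_ + potential_dl _ _ _]addrC addrK.
rewrite [X in _ + X](_ : _ = - potential_dr rho^-1 a b); last first.
  by rewrite potentialSr // opprD addNKr.
rewrite -(subnKC hab); set e := (b - a)%N.
(* An empty shorter queue has no departure, so its equation has one term fewer. *)
case: a {hab ha} @e => [|a] e; rewrite /=.
  rewrite /potential_dl /potential_dr subSS subn0 !add0n.
  rewrite (geom_sumSl _ _ e.+1) geom_sumSr mixed_sumS.
  rewrite /mixed_sum !big_geq // !exprS expr0; by field.
rewrite (potentialSl _ _ a) opprD addNKr.
rewrite /potential_dl /potential_dr.
have -> : ((a.+1 + e).+1 - a.+2 = e)%N by lia.
have -> : ((a.+1 + e).+1 - a.+1 = e.+1)%N by lia.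
rewrite !addSn !addnS geom_sumSl (geom_sumSr _ _ e) (mixed_sumS _ _ a.+1).
rewrite !exprS !exprD !exprMn; by field.
Qed.

(** * Flow balance across the levels of the total *)

Lemma drift_total (R : realFieldType) (rho : R) (K n a b : nat) :
  (n < 2 * K)%N -> (a <= K)%N -> (b <= K)%N ->
  jsq_drift K rho (fun a b => (n < a + b)%N%:R) a b
  = 2 * rho * (a + b == n)%N%:R
    - ((0 < a) + (0 < b))%N%:R * (a + b == n.+1)%N%:R.
Proof.
move=> hn ha hb; rewrite /jsq_drift /jsq_arrival /=.
have up : (n < (a + b).+1)%N%:R - (n < a + b)%N%:R = (a + b == n)%N%:R :> R.
  by rewrite ltnS leq_eqVlt eq_sym; case: ltngtP; rewrite /= ?subrr ?subr0.
have down c : (c.+1 = a + b)%N ->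
    (n < c)%N%:R - (n < a + b)%N%:R = - (a + b == n.+1)%N%:R :> R.
  move=> <-; rewrite ltnS eqSS eq_sym.
  by case: ltngtP; rewrite /= ?subrr ?sub0r ?oppr0.
have -> : (if (0 < a)%N then (n < a.-1 + b)%N%:R - (n < a + b)%N%:R else 0)
    = - (0 < a)%N%:R * (a + b == n.+1)%N%:R :> R.
  case: posnP => ha0; first by rewrite oppr0 mul0r.
  by rewrite down ?mulN1r //; lia.
have -> : (if (0 < b)%N then (n < a + b.-1)%N%:R - (n < a + b)%N%:R else 0)
    = - (0 < b)%N%:R * (a + b == n.+1)%N%:R :> R.
  case: posnP => hb0; first by rewrite oppr0 mul0r.
  by rewrite down ?mulN1r //; lia.
rewrite addSn addnS up natrD.
have [hab|hab|hab] := ltngtP a b.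
- by rewrite (leq_trans hab hb); case: ifP => _; ring.
- by rewrite (leq_trans hab ha); case: ifP => _; ring.
(* Arrivals are lost only at (K, K), where the total 2K exceeds n. *)
rewrite -hab; case: ltngtP ha => // [_ _|haK _]; first by ring.
by rewrite (_ : (a + a == n)%N = false) ?mulr0n; [ring|lia].
Qed.

Lemma prob_totalS (R : realFieldType) (rho : R) (K n : nat)
    (p : jsq_state K -> R) :
  invariant_measure (jsq_generator rho) p -> (n < 2 * K)%N ->
  2 * rho * prob p (fun s => jsq_total s == n)
  = \sum_(s : jsq_state K | jsq_total s == n.+1)
      ((0 < s.1) + (0 < s.2))%N%:R * p s.
Proof.
move=> hp hn; apply/eqP; rewrite -subr_eq0; apply/eqP.
rewrite -[RHS](invariant_drift _ _ _ _ (fun a b => (n < a + b)%N%:R) hp).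
rewrite /prob mulr_sumr [X in X - _]big_mkcond [X in _ - X]big_mkcond -sumrB /=.
apply: eq_bigr => s _; rewrite drift_total ?leq_ord // -/(jsq_total s).
by case: eqP; case: eqP => _ _; rewrite /= ?mulr1n ?mulr0n; ring.
Qed.

Lemma prob_totalS_ge (R : realFieldType) (rho : R) (K n : nat)
    (p : jsq_state K -> R) :
  (forall s, 0 <= p s) ->
  invariant_measure (jsq_generator rho) p -> (n < 2 * K)%N ->
  rho * prob p (fun s => jsq_total s == n)
  <= prob p (fun s => jsq_total s == n.+1).
Proof.
move=> p0 hp hn; rewrite -(ler_pM2l (ltr0n R 2)) mulrA prob_totalS //.
rewrite /prob mulr_sumr; apply: ler_sum => s _; apply: ler_wpM2r => //.
by rewrite ler_nat; do 2 case: (0 < _)%N.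
Qed.

Lemma prob_totalS_eq (R : realFieldType) (rho : R) (K n : nat)
    (p : jsq_state K -> R) :
  invariant_measure (jsq_generator rho) p -> (K <= n < 2 * K)%N ->
  rho * prob p (fun s => jsq_total s == n)
  = prob p (fun s => jsq_total s == n.+1).
Proof.
move=> hp /andP[hKn hn]; apply: (mulfI (_ : 2 != 0)); first by rewrite pnatr_eq0.
rewrite mulrA prob_totalS // /prob mulr_sumr; apply: eq_bigr => s.
rewrite /jsq_total => /eqP hs; have := leq_ord s.1; have := leq_ord s.2.
(* If one queue were empty, the other would hold n + 1 > K customers. *)
by move=> h2 h1; rewrite (_ : (0 < s.1)%N) 1?(_ : (0 < s.2)%N) //; lia.
Qed.

Lemma prob_total_max (R : realFieldType) (K : nat) (p : jsq_state K -> R) :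
  prob p (fun s => jsq_total s == (2 * K)%N) = p (ord_max, ord_max).
Proof.
rewrite /prob (big_pred1 ((ord_max, ord_max) : jsq_state K)) // => -[i j].
rewrite /= /jsq_total /= xpair_eqE -!val_eqE /=.
have := leq_ord i; have := leq_ord j; lia.
Qed.

(** * Normalization at the full state *)

Lemma invariant_full_state (R : realFieldType) (rho : R) (K : nat)
    (p : jsq_state K -> R) :
  0 < rho -> jsq_invariant_distribution rho p ->
  p (ord_max, ord_max) * drift_const rho^-1 K = 1.
Proof.
move=> hrho [[_ p1] hp]; apply/esym/eqP; rewrite -subr_eq0; apply/eqP.
rewrite -[RHS](invariant_drift _ _ _ _
  (fun a b => potential rho^-1 (minn a b) (maxn a b)) hp) -[X in X - _]p1.
rewrite (bigD1 ((ord_max, ord_max) : jsq_state K)) //=.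
rewrite [RHS](bigD1 ((ord_max, ord_max) : jsq_state K)) //=.
rewrite drift_potential ?leq_ord // !eqxx /= mulr1n mulr1 addrAC [in RHS]mulrBr mulr1.
congr (_ + _); apply: eq_bigr => -[i j]; rewrite xpair_eqE -!val_eqE /= => hij.
by rewrite drift_potential ?leq_ord // (negbTE hij) mulr0n mulr0 subr0 mulr1.
Qed.

Lemma drift_constE (R : realFieldType) (rho : R) (K : nat) : 0 < rho ->
  2 * rho ^+ (2 * K) * drift_const rho^-1 K
  = 2 * (\sum_(0 <= k < (2 * K).+1) rho ^+ k)
    - \sum_(0 <= k < K) (rho / 2) ^+ k.
Proof.
move=> hrho; have rho0 : rho != 0 by rewrite gt_eqF.
have hpow m n : (n <= m)%N -> rho ^+ m * rho^-1 ^+ n = rho ^+ (m - n).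
  by move=> h; rewrite exprVn -expfB_cond // (negbTE rho0).
rewrite /drift_const mulrBr; congr (_ - _).
  rewrite -mulrA; congr (_ * _); rewrite /geom_sum mulr_sumr big_nat_rev /=.
  apply: eq_big_nat => i /andP[_ hi]; rewrite hpow; last by lia.
  by congr (_ ^+ _); lia.
transitivity (rho ^+ (2 * K) * (rho^-1 ^+ K.+1 * mixed_sum rho^-1 K)).
  by field.
(* The power of rho in the i-th term is 2K - (K + 1) - (K - i - 1) = i. *)
rewrite /mixed_sum !mulr_sumr; apply: eq_big_nat => i /andP[_ hi].
rewrite !mulrA -(mulrA (rho ^+ _)) -exprD hpow; last by lia.
by rewrite exprMn; congr (_ ^+ _ * _); lia.
Qed.

Theorem lemma1 (R : realFieldType) (rho : R) (hrho : 0 < rho) (K : nat)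
    (piK : jsq_state K -> R)
    (hpi : jsq_invariant_distribution rho piK) :
  [/\ forall n : nat, (n < K)%N ->
        prob piK (fun s => jsq_total s == n)
          <= piK (ord_max, ord_max) / rho ^+ (2 * K) * rho ^+ n,
      forall n : nat, (K <= n <= 2 * K)%N ->
        prob piK (fun s => jsq_total s == n)
          = piK (ord_max, ord_max) / rho ^+ (2 * K) * rho ^+ n
    & piK (ord_max, ord_max)
        = 2 * rho ^+ (2 * K)
          / (2 * (\sum_(0 <= k < (2 * K).+1) rho ^+ k)
             - \sum_(0 <= k < K) (rho / 2) ^+ k)].
Proof.
have [[p0 _] hp] := hpi; have rho0 : rho != 0 by rewrite gt_eqF.
have hle n : (n <= 2 * K)%N -> prob piK (fun s => jsq_total s == n)
    <= piK (ord_max, ord_max) / rho ^+ (2 * K) * rho ^+ n.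
  (* Descending induction from level 2K, whose only state is (K, K). *)
  move=> /subKn <-; elim: (2 * K - n)%N => [|m IH].
    by rewrite subn0 prob_total_max divfK ?expf_neq0.
  (* Once m reaches 2K, truncated subtraction keeps the level at 0 and the induction hypothesis
     applies unchanged. *)
  case: (ltnP m (2 * K)) => hm; last first.
    by rewrite (_ : 2 * K - m.+1 = 2 * K - m)%N //; lia.
  rewrite -(ler_pM2l hrho) (le_trans (prob_totalS_ge _ _ _ _ _ p0 hp _)) //.
    by lia.
  have -> : (2 * K - m.+1).+1 = (2 * K - m)%N by lia.
  by rewrite mulrCA -exprS (_ : (2 * K - m.+1).+1 = 2 * K - m)%N //; lia.
split.
- by move=> n hn; apply: hle; lia.
- move=> n /andP[hKn hn]; move: hKn; rewrite -(subKn hn).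
  elim: (2 * K - n)%N => [|m IH] hK.
    by rewrite subn0 prob_total_max divfK ?expf_neq0.
  case: (ltnP m (2 * K)) => hm; last first.
    by rewrite (_ : 2 * K - m.+1 = 2 * K - m)%N ?IH //; lia.
  apply: (mulfI rho0); rewrite prob_totalS_eq //; last by lia.
  have e : (2 * K - m.+1).+1 = (2 * K - m)%N by lia.
  by rewrite e IH 1?mulrCA -?exprS ?e //; lia.
have h := invariant_full_state _ _ _ _ hrho hpi.
(* The constant is nonzero because its product with the probability of (K, K) is 1; no sign estimate
   of the denominator is required. *)
have c0 : drift_const rho^-1 K != 0.
  by apply: contra_eq_neq h => ->; rewrite mulr0 eq_sym oner_neq0.
rewrite -drift_constE // invfM mulrA divff ?mul1r.
  by apply: (mulIf c0); rewrite h mulVf.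
by rewrite mulf_neq0 ?pnatr_eq0 ?expf_neq0.
Qed.
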